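(* Let $\mathcal X$ be a measurable space, let $\Phi=\{g_1,\dots,g_d\}$ be a finite nonempty set of real-valued measurable functions on $\mathcal X$, and let $\mathcal P$ be the hypothesis generated by $\Phi$. A function $f\in\mathcal L^\Phi$ satisfies $\int_{\mathcal X} f\,d\mu\le 0$ for all $\mu\in\mathcal P$ if and only if $$f\le \sum_{i=1}^d \pi_i g_i,\quad \mathcal P\text{-q.s.}$$ for some $\pi=(\pi_1,\dots,\pi_d)\in\mathbb R^d_+$. In particular, the set of all e-variables for $\mathcal P$ consists precisely of those $[0,\infty]$-valued measurable functions on $\mathcal X$ which are $\mathcal P$-q.s. dominated by $$1+\sum_{i=1}^d \pi_i g_i$$ for some $\pi=(\pi_1,\dots,\pi_d)\in\mathbb R^d_+$.
   Context: $\mathcal M_1$ is the set of probability measures on $\mathcal X$. The hypothesis generated by $\Phi$ is the (possibly empty) set $$\mathcal P = \{\mu \in \mathcal M_1 : \int_{\mathcal X} |f|\, d\mu < \infty \text{ and } \int_{\mathcal X} f\, d\mu \le 0 \text{ for all } f \in \Phi\}.$$ $\mathcal L^\Phi$ is the set of real-valued measurable functions $f$ on $\mathcal X$ with $\int|f|\,d\mu<\infty$ for all $\mu\in\mathcal P$. A measurable set $A$ is $\mathcal P$-negligible if $\mu(A)=0$ for all $\mu\in\mathcal P$; a pointwise property holds $\mathcal P$-quasi-surely ($\mathcal P$-q.s.) if the set where it fails is $\mathcal P$-negligible. An e-variable for $\mathcal P$ is a measurable $h:\mathcal X\to[0,\infty]$ with $\int_{\mathcal X} h\,d\mu\le 1$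 for all $\mu\in\mathcal P$. $\mathbb R^d_+=[0,\infty)^d$. *)

(* Defs.v *)
From HB Require Import structures.
From mathcomp Require Import all_boot all_order all_algebra.
From mathcomp Require Import all_classical all_reals all_analysis measurable_realfun.

Set Implicit Arguments.
Unset Strict Implicit.
Unset Printing Implicit Defensive.

Import Order.TTheory GRing.Theory Num.Theory.
Import numFieldNormedType.Exports.

Local Open Scope classical_set_scope.
Local Open Scope ring_scope.

Section GeneratedHypotheses.
Context {d : measure_display} {X : measurableType d} {R : realType}.
Implicit Types (Phi : set (X -> R)) (P : set (probability X R)).

(* [integrable] includes measurability, which is assumed of the elements of
   [Phi] anyway. *)
Definition generated_hypothesis Phi : set (probability X R) :=
  [set mu | forall f, Phi f ->
     mu.-integrable setT (EFin \o f) /\ (\int[mu]_x (f x)%:E <= 0)%E].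

Definition calL Phi : set (X -> R) :=
  [set f | measurable_fun setT f /\
     forall mu, generated_hypothesis Phi mu ->
       mu.-integrable setT (EFin \o f)].

Definition hyp_negligible P (A : set X) : Prop :=
  measurable A /\ forall mu, P mu -> mu A = 0%E.

Definition quasi_surely P (Q : X -> Prop) : Prop :=
  hyp_negligible P [set x | ~ Q x].

Definition e_variables P : set (X -> \bar R) :=
  [set h : X -> \bar R |
     [/\ measurable_fun setT h, forall x, (0 <= h x)%E &
       forall mu, P mu -> (\int[mu]_x h x <= 1)%E]].

End GeneratedHypotheses.

(* Main.v *)
(* Dual vectors come from separating cones in a finite-dimensional space.
   Repeatedly restricting to [{x | p . g x = 0}], for p >= 0 with p . g >= 0,
   yields a set T of full measure for every mu in P on which p . g >= 0 forces
   p . g = 0; each step lowers the dimension of the span of g, so this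
   terminates.  If f integrates to at most 0 under every finitely supported
   measure in P carried by T, then (0, -1) lies outside the cone generated by
   the vectors (g y, - f y) for y in T, (e_i, 0) and (0, 1).  Although this cone
   need not be closed, the property of T produces a nonnegative functional of
   the form (p, 1) on it, that is, p >= 0 with f <= p . g on T.  For an
   e-variable h, this applies to f = h - 1, h being finite quasi-surely. *)
Require Import Defs.
From HB Require Import structures.
From mathcomp Require Import all_boot all_order all_algebra.
From mathcomp Require Import all_classical all_reals all_analysis measurable_realfun.
From mathcomp Require Import lra.

Set Implicit Arguments.
Unset Strict Implicit.
Unset Printing Implicit Defensive.

Import Order.TTheory GRing.Theory Num.Theory.
Import numFieldNormedType.Exports.

Local Open Scope classical_set_scope.
Local Open Scope ring_scope.

(** * Convex cones and separation in finite dimension *)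

Section Cones.
Context {R : realType}.

Definition convex_cone (V : lmodType R) (C : set V) : Prop :=
  [/\ C 0, forall u v, C u -> C v -> C (u + v) &
      forall (a : R) v, 0 <= a -> C v -> C (a *: v)].

(** Combinations grow by one generator at a time, so that induction can assemble a measure step by
    step in [conic_hull_measure]. *)
Inductive conic_hull (V : lmodType R) (S : set V) : set V :=
| conic_hull0 : conic_hull S 0
| conic_hullD a v w :
    0 <= a -> S v -> conic_hull S w -> conic_hull S (a *: v + w).

Lemma conic_hull_cone (V : lmodType R) (S : set V) :
  convex_cone (conic_hull S).
Proof.
split; first exact: conic_hull0.
- move=> u v + Cv; elim=> [|a x w a0 Sx _ IH]; first by rewrite add0r.
  by rewrite -addrA; exact: conic_hullD.
- move=> a v a0; elim=> [|b x w b0 Sx _ IH].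
    by rewrite scaler0; exact: conic_hull0.
  by rewrite scalerDr scalerA; apply: conic_hullD => //; exact: mulr_ge0.
Qed.

Lemma sub_conic_hull (V : lmodType R) (S : set V) : S `<=` conic_hull S.
Proof.
move=> v Sv; rewrite -[v]addr0 -[v in v + _]scale1r.
by apply: conic_hullD => //; exact: conic_hull0.
Qed.

Lemma conic_hull_mono (V : lmodType R) (S S' : set V) :
  S `<=` S' -> conic_hull S `<=` conic_hull S'.
Proof.
move=> SS' v; elim=> [|a x w a0 Sx _ IH]; first exact: conic_hull0.
by apply: conic_hullD => //; exact: SS'.
Qed.

Definition dotc n (v : 'rV[R]_n) (p : 'cV[R]_n) : R := (v *m p) 0 0.

Lemma dotcDl n (u v : 'rV[R]_n) p : dotc (u + v) p = dotc u p + dotc v p.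
Proof. by rewrite /dotc mulmxDl mxE. Qed.

Lemma dotcZl n a (v : 'rV[R]_n) p : dotc (a *: v) p = a * dotc v p.
Proof. by rewrite /dotc -scalemxAl mxE. Qed.

Lemma dotcDr n (v : 'rV[R]_n) p q : dotc v (p + q) = dotc v p + dotc v q.
Proof. by rewrite /dotc mulmxDr mxE. Qed.

Lemma dotcZr n a (v : 'rV[R]_n) p : dotc v (a *: p) = a * dotc v p.
Proof. by rewrite /dotc -scalemxAr mxE. Qed.

Lemma dot0c n (p : 'cV[R]_n) : dotc 0 p = 0.
Proof. by rewrite /dotc mul0mx mxE. Qed.

Lemma dotcE n (v : 'rV[R]_n) p : dotc v p = \sum_i p i 0 * v 0 i.
Proof. by rewrite /dotc mxE; apply: eq_bigr => i _; rewrite mulrC. Qed.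

Lemma dotc_row m n (u : 'rV[R]_m) (v : 'rV[R]_n) p q :
  dotc (row_mx u v) (col_mx p q) = dotc u p + dotc v q.
Proof. by rewrite /dotc mul_row_col mxE. Qed.

Lemma dotc_delta n (i : 'I_n) (p : 'cV[R]_n) : dotc (delta_mx 0 i) p = p i 0.
Proof. by rewrite /dotc -rowE mxE. Qed.

Lemma dotc_scalar (a b : R) : dotc a%:M b%:M = a * b.
Proof. by rewrite /dotc -scalar_mxM mxE eqxx. Qed.

Lemma dotc_ge0_conic_hull n (S : set 'rV[R]_n) (p : 'cV[R]_n) v :
  (forall s, S s -> 0 <= dotc s p) -> conic_hull S v -> 0 <= dotc v p.
Proof.
move=> Sp; elim=> [|a x w a0 Sx _ IH]; first by rewrite dot0c.
by rewrite dotcDl dotcZl addr_ge0// mulr_ge0// Sp.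
Qed.

(* Induction on the dimension: a functional on the hyperplane of vanishing
   first coordinate extends as in M. Riesz's theorem, unless the first
   coordinate itself is nonnegative on [D]. *)
Lemma orthant_cone_support k (D : set 'rV[R]_k) : convex_cone D ->
  (forall i, D (delta_mx 0 i)) -> (exists v, ~ D v) ->
  exists p : 'cV[R]_k, [/\ forall i, 0 <= p i 0, exists i, 0 < p i 0 &
    forall v, D v -> 0 <= dotc v p].
Proof.
elim: k D => [|k IH].
  by move=> D [D0 _ _] _ [z] []; rewrite (_ : z = 0)//; apply/rowP => -[].
rewrite -[k.+1]/(1 + k)%N => D cD De [z Dz].
have [D0 DD DZ] := cD.
pose mk (a : R) (v : 'rV[R]_k) : 'rV[R]_(1 + k) := row_mx a%:M v.
have mkE (w : 'rV[R]_(1 + k)) : w = mk (w 0 0) (rsubmx w).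
  rewrite -[LHS]hsubmxK; congr row_mx; apply/rowP => i.
  by rewrite !mxE !ord1 eqxx mulr1n; congr (w _ _); apply/val_inj.
have mkD a b u v : mk a u + mk b v = mk (a + b) (u + v).
  by rewrite /mk add_row_mx raddfD.
have mkZ a b u : a *: mk b u = mk (a * b) (a *: u).
  by rewrite /mk scale_row_mx scale_scalar_mx.
have mkV (a : R) (w : 'rV_(1 + k)) : a *: w = mk (a * w 0 0) (a *: rsubmx w).
  by rewrite -mkZ -mkE.
have De0 : D (mk 1 0).
  suff -> : mk 1 0 = delta_mx 0 (lshift k ord0) by exact: De.
  rewrite /mk delta_mx_lshift; congr row_mx; apply/matrixP => i j.
  by rewrite !mxE !ord1.
(* Without such an element, rescaling shows that the first coordinate is nonnegative on [D], and it
   serves as the functional itself. *)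
have [neg|pos] := pselect (exists v, D (mk (-1) v)); last first.
  exists (col_mx (1%:M : 'M[R]_1) (0 : 'cV[R]_k)); split.
  - by move=> i; rewrite mxE; case: splitP => j _; rewrite !mxE.
  - by exists (lshift k (0 : 'I_1)); rewrite col_mxEu mxE eqxx.
  move=> v Dv.
  rewrite leNgt; apply/negP => v_lt0; apply: pos.
  rewrite [v]mkE dotc_row dotc_scalar mulr1 /dotc mulmx0 mxE addr0 in v_lt0.
  exists ((- (v 0 0))^-1 *: rsubmx v).
  have -> : mk (-1) ((- (v 0 0))^-1 *: rsubmx v) = (- (v 0 0))^-1 *: v.
    by rewrite mkV invrN mulNr mulVf// lt_eqF.
  by apply: DZ => //; rewrite invr_ge0 oppr_ge0 ltW.
case: neg => v1 Dv1.
pose D' : set 'rV[R]_k := [set v | D (mk 0 v)].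
have cD' : convex_cone D'.
  split.
  - by rewrite /D'/= /mk raddf0 row_mx0.
  - by move=> u v Du Dv; rewrite /D'/= -[0]addr0 -mkD; exact: DD.
  - by move=> a v a0 Dv; rewrite /D'/= -(mulr0 a) -mkZ; exact: DZ.
have [] := IH D' cD'.
- move=> i; rewrite /D'/=.
  suff -> : mk 0 (delta_mx 0 i) = delta_mx 0 (rshift 1 i) by exact: De.
  by rewrite /mk raddf0 delta_mx_rshift.
(* If [D'] were everything, [mk 1 0] and [mk (-1) v1] would supply both signs of the first
   coordinate, and [D] would contain [z]. *)
- apply: contrapT => /forallNP D'T; apply: Dz.
  have D'E v : D (mk 0 v) by apply: contrapT; exact: D'T.
  have [z0|z0] := leP 0 (z 0 0).
    rewrite [z]mkE -[z 0 0]addr0 -[rsubmx z]add0r -mkD; apply: DD => //.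
    by rewrite -(mulr1 (z 0 0)) -(scaler0 _ (z 0 0)) -mkZ; exact: DZ.
  have -> : z = (- z 0 0) *: mk (-1) v1 + mk 0 (rsubmx z + z 0 0 *: v1).
    rewrite mkZ mkD [LHS]mkE mulrN1 opprK addr0; congr mk.
    by rewrite scaleNr addrC addrK.
  by apply: DD => //; apply: DZ => //; rewrite oppr_ge0 ltW.
move=> p [p_ge0 [i pi] D'p].
(* The first component [s] of the extension must satisfy [- dotc v p <= s] when [mk 1 v] is in [D],
   and [s <= dotc v p] when [mk (-1) v] is. The choice [s = sup L] is nonnegative because [L]
   contains 0. *)
pose L : set R := [set - dotc v p | v in [set v | D (mk 1 v)]].
have L0 : L 0 by exists 0; rewrite ?dot0c ?oppr0.
have ubL v : D (mk (-1) v) -> ubound L (dotc v p).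
  move=> Dv _ [u Du <-]; rewrite lerNl -subr_ge0 opprK -dotcDl.
  by apply: D'p; rewrite /D'/= -(subrr 1) -mkD; exact: DD.
have supL : has_sup L by split; [exists 0|exists (dotc v1 p); exact: ubL].
exists (col_mx ((sup L)%:M : 'M[R]_1) p); split.
- move=> j; rewrite mxE; case: splitP => l _ //.
  by rewrite mxE !ord1 eqxx; exact: sup_upper_bound.
- by exists (rshift 1 i); rewrite col_mxEd.
move=> v Dv.
rewrite [v]mkE dotc_row dotc_scalar.
have [v0|v0|v0] := ltgtP (v 0 0) 0.
- have : sup L <= dotc ((- (v 0 0))^-1 *: rsubmx v) p.
    apply: ge_sup; first by exists 0.
    apply: ubL.
    have -> : mk (-1) ((- (v 0 0))^-1 *: rsubmx v) = (- (v 0 0))^-1 *: v.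
      by rewrite mkV invrN mulNr mulVf// lt_eqF.
    by apply: DZ => //; rewrite invr_ge0 oppr_ge0 ltW.
  rewrite dotcZl mulrC ler_pdivlMr ?oppr_gt0//; lra.
- have : - dotc ((v 0 0)^-1 *: rsubmx v) p <= sup L.
    apply: sup_upper_bound => //; exists ((v 0 0)^-1 *: rsubmx v) => //=.
    have -> : mk 1 ((v 0 0)^-1 *: rsubmx v) = (v 0 0)^-1 *: v.
      by rewrite mkV mulVf// gt_eqF.
    by apply: DZ => //; rewrite invr_ge0 ltW.
  rewrite dotcZl -mulrN mulrC ler_pdivrMr//; lra.
- by rewrite v0 mul0r add0r; apply: D'p; rewrite /D'/= -v0 -mkE.
Qed.

(** A free family drawn from [C] can be enlarged by any member of [C] outside its span, at most [n]
    times in all. *)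
Lemma cone_basis n (C : set 'rV[R]_n) : exists k (B : 'M[R]_(k, n)),
  [/\ row_free B, forall i, C (row i B) & forall v, C v -> (v <= B)%MS].
Proof.
suff: forall r k (B : 'M[R]_(k, n)), (n - k <= r)%N -> row_free B ->
    (forall i, C (row i B)) -> exists k (B : 'M[R]_(k, n)),
  [/\ row_free B, forall i, C (row i B) & forall v, C v -> (v <= B)%MS].
  by move=> /(_ n 0 0); apply; rewrite ?subn0// /row_free ?mxrank0// => -[].
elim=> [|r IH] k B nk Bfree BC.
  exists k, B; split => // v _; apply: submx_full.
  rewrite /row_full eqn_leq rank_leq_col/=.
  by rewrite (eqP Bfree) -subn_eq0 -leqn0.
have [[v [Cv vB]]|/forallNP H] := pselect (exists v, C v /\ ~~ (v <= B)%MS).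
  apply: (IH (1 + k)%N (col_mx v B)).
  - by rewrite add1n subnS -ltnS; case: (n - k)%N nk.
  - have : (\rank B < \rank (col_mx v B))%N.
      rewrite ltn_neqAle -addsmxE mxrankS ?addsmxSr// andbT.
      apply: contra vB => /eqP rB.
      apply: (@submx_trans _ _ _ _ _ _ (v + B)%MS); first exact: addsmxSl.
      by have [_ <-] := mxrank_leqif_sup (addsmxSr v B); rewrite rB.
    by rewrite (eqP Bfree) /row_free eqn_leq rank_leq_row.
  - move=> i; case: (split_ordP i) => j ->; last by rewrite rowKd.
    by rewrite rowKu row_id.
exists k, B; split => // v Cv.
by apply: contrapT => vB; apply: (H v); split => //; apply/negP.
Qed.

(* In the coordinates of a basis drawn from [C], the cone [C] contains the
   orthant. *)
Lemma cone_support n (C : set 'rV[R]_n) v : convex_cone C -> C v -> ~ C (- v) ->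
  exists2 p : 'cV[R]_n, (forall c, C c -> 0 <= dotc c p) &
    exists2 c, C c & 0 < dotc c p.
Proof.
move=> [C0 CD CZ] Cv CNv; have [k [B [Bfree BC CB]]] := cone_basis C.
have KB c : C c -> c = c *m pinvmx B *m B by move=> /CB/mulmxKpV.
have [||| p [_ [i pi] Dp]] := @orthant_cone_support k [set u | C (u *m B)].
- split => /=; first by rewrite mul0mx.
  + by move=> x y Cx Cy; rewrite mulmxDl; exact: CD.
  + by move=> a x a0 Cx; rewrite -scalemxAl; exact: CZ.
- by move=> i /=; rewrite -rowE.
- by exists (- (v *m pinvmx B)); rewrite /= mulNmx -KB.
(* [pinvmx B] is a right inverse of the free [B], so it turns a functional on coordinates into one
   on the ambient space. *)
have dotB u : dotc (u *m B) (pinvmx B *m p) = dotc u p.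
  by rewrite /dotc mulmxA -(mulmxA u) mulmxVp// mulmx1.
exists (pinvmx B *m p).
  by move=> c Cc; rewrite (KB _ Cc) dotB; apply: Dp; rewrite /= -KB.
by exists (row i B) => //; rewrite rowE dotB dotc_delta.
Qed.

(** A supporting functional vanishing at [z] would by the second hypothesis vanish on [S], hence on
    the whole hull, although it is positive somewhere there. So it is positive at [z] and can be
    rescaled. *)
Lemma strict_separation n (S : set 'rV[R]_n) (z : 'rV[R]_n) :
  ~ conic_hull (z |` S) (- z) ->
  (forall p, (forall s, S s -> 0 <= dotc s p) -> dotc z p = 0 ->
     forall s, S s -> dotc s p = 0) ->
  exists2 p : 'cV[R]_n, (forall s, S s -> 0 <= dotc s p) & dotc z p = 1.
Proof.
move=> Nz NA.
have Hz : conic_hull (z |` S) z by apply: sub_conic_hull; left.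
have [p p0 [c Cc cp]] := cone_support (conic_hull_cone _) Hz Nz.
have Sp s : S s -> 0 <= dotc s p by move=> Ss; apply/p0/sub_conic_hull; right.
have [zp|zp] := eqVneq (dotc z p) 0.
  have : 0 <= dotc c (- p).
    apply: dotc_ge0_conic_hull Cc => s Ss.
    rewrite -scaleN1r dotcZr mulN1r; case: Ss => [->|Ss].
      by rewrite zp oppr0.
    by rewrite (NA _ Sp zp)// oppr0.
  by rewrite -scaleN1r dotcZr mulN1r oppr_ge0 leNgt cp.
have zp0 : 0 < dotc z p by rewrite lt_def zp p0.
exists ((dotc z p)^-1 *: p); last by rewrite dotcZr mulVf.
by move=> s Ss; rewrite dotcZr mulr_ge0 ?Sp// invr_ge0 ltW.
Qed.

Lemma finite_domination (T : eqType) (a b : T -> R) (E : seq T) :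
  exists2 M : R, 0 <= M &
    forall e, e \in E -> 0 < b e -> 0 <= a e + M * b e.
Proof.
elim: E => [|x E [M M0 IH]]; first by exists 0.
(* If [b x] is 0, so is the quotient; the increment is nonnegative in every case, which preserves
   the earlier bounds. *)
exists (M + `|a x| / `|b x|); first by rewrite addr_ge0// divr_ge0.
move=> e; rewrite in_cons mulrDl => /predU1P[->|eE] be.
  rewrite (gtr0_norm be) divfK ?gt_eqF// addrCA addr_ge0//.
    by rewrite mulr_ge0// ltW.
  by rewrite -lerBlDl sub0r -[`|a x|]normrN ler_norm.
by rewrite addrA addr_ge0 ?IH// mulr_ge0 ?divr_ge0// ltW.
Qed.

(* Induction on the size of [E]: if some functional vanishing at [z] is
   nonnegative on [S] and [E] but positive somewhere on [E], the members of [E]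
   where it is positive can be dropped, since a large multiple of it can be
   added afterwards. *)
Lemma polyhedral_separation n (S : set 'rV[R]_n) (E : seq 'rV[R]_n)
    (z : 'rV[R]_n) :
  ~ conic_hull (z |` (S `|` [set` E])) (- z) ->
  (forall p, (forall s, S s -> 0 <= dotc s p) ->
     (forall e, e \in E -> 0 <= dotc e p) -> dotc z p = 0 ->
     forall s, S s -> dotc s p = 0) ->
  exists p : 'cV[R]_n, [/\ forall s, S s -> 0 <= dotc s p,
    forall e, e \in E -> 0 <= dotc e p & dotc z p = 1].
Proof.
have [m] := ubnP (size E); elim: m E => // m IH E /ltnSE Em Nz NA.
have [[q [Sq Eq zq [e0 e0E qe0]]]|noq] := pselect (exists q : 'cV[R]_n,
    [/\ forall s, S s -> 0 <= dotc s q, forall e, e \in E -> 0 <= dotc e q,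
    dotc z q = 0 & exists2 e, e \in E & dotc e q != 0]); last first.
  (* Without such a [q], the functionals that satisfy the sign conditions and vanish at [z] vanish
     on [E] too, so [strict_separation] applies to the union. *)
  have [p pge0 zp] : exists2 p : 'cV[R]_n,
      (forall s, (S `|` [set` E]) s -> 0 <= dotc s p) & dotc z p = 1.
    apply: strict_separation => // p p0 zp s [Ss|Es].
      by apply: (NA p) => // [t St|t Et]; apply: p0; [left|right].
    apply: contrapT => /eqP sp; apply: noq; exists p; split => //.
    - by move=> t St; apply: p0; left.
    - by move=> t Et; apply: p0; right.
    - by exists s.
  by exists p; split => // [s Ss|e Ee]; apply: pge0; [left|right].
(* Adding a multiple of [q] thus leaves the values on [S] and at [z] unchanged. *)
have Sq0 := NA q Sq Eq zq.
pose E' := [seq e <- E | dotc e q == 0].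
have lift p : (forall e, e \in E' -> 0 <= dotc e p) ->
    exists M : R, forall e, e \in E -> 0 <= dotc e (p + M *: q).
  move=> E'p.
  have [M M0 hM] := finite_domination (fun e => dotc e p) (fun e => dotc e q) E.
  exists M => e Ee; rewrite dotcDr dotcZr.
  have [eq0|eqN0] := eqVneq (dotc e q) 0.
    by rewrite eq0 mulr0 addr0; apply: E'p; rewrite mem_filter eq0 eqxx.
  by apply: hM => //; rewrite lt_def eqN0 Eq.
have liftE M p s : dotc s q = 0 -> dotc s (p + M *: q) = dotc s p.
  by move=> sq; rewrite dotcDr dotcZr sq mulr0 addr0.
have [||| p [Sp E'p zp]] := IH E'.
- apply: leq_trans Em; rewrite size_filter.
  rewrite -(count_predC (fun e => dotc e q == 0)).
  by rewrite -[ltnLHS]addn0 ltn_add2l -has_count; apply/hasP; exists e0.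
- apply: contra_not Nz; apply: conic_hull_mono => s [->|]; first by left.
  case=> [Ss|/=]; first by right; left.
  by rewrite mem_filter => /andP[_ Es]; right; right.
- move=> p Sp E'p zp s Ss; have [M EM] := lift p E'p.
  rewrite -(liftE M) ?Sq0//; apply: NA => //; last by rewrite liftE.
  by move=> t St; rewrite liftE ?Sq0// Sp.
have [M EM] := lift p E'p; exists (p + M *: q); split => //.
  by move=> t St; rewrite liftE ?Sq0// Sp.
by rewrite liftE.
Qed.

End Cones.

(** * Integration against scaled, added and point measures *)

Section FiniteMeasures.
Local Open Scope ereal_scope.
Context {d : measure_display} {X : measurableType d} {R : realType}.
Implicit Types (nu : {measure set X -> \bar R}) (h : X -> \bar R).

Lemma integrable_mscale (k : {nonneg R}) nu h :
  nu.-integrable setT h -> (mscale k nu).-integrable setT h.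
Proof.
move=> /integrableP[mh hoo]; apply/integrableP; split => //.
rewrite ge0_integral_mscale//; last exact: measurableT_comp.
by rewrite lte_mul_pinfty.
Qed.

Lemma integral_mscale (k : {nonneg R}) nu h : nu.-integrable setT h ->
  \int[mscale k nu]_x h x = k%:num%:E * \int[nu]_x h x.
Proof.
move=> nuh; have /integrableP[mh _] := nuh.
rewrite [\int[mscale k nu]_x h x]integralE [\int[nu]_x h x]integralE muleBr//.
  rewrite !ge0_integral_mscale//; first exact: measurable_funeneg.
  exact: measurable_funepos.
exact: integrable_add_def.
Qed.

Lemma integrable_measure_add nu nu' h :
  nu.-integrable setT h -> nu'.-integrable setT h ->
  (measure_add nu nu').-integrable setT h.
Proof.
move=> /integrableP[mh hoo] /integrableP[_ hoo'].
apply/integrableP; split => //.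
rewrite ge0_integral_measure_add//; last exact: measurableT_comp.
exact: lte_add_pinfty.
Qed.

Lemma integrable_dirac (a : X) (h : X -> R) : measurable_fun setT h ->
  (\d_a : {measure set X -> \bar R}).-integrable setT (EFin \o h).
Proof.
move=> mh; have mEh : measurable_fun setT (EFin \o h) by exact/measurable_EFinP.
apply/integrableP; split => //.
rewrite integral_dirac//; last exact: measurableT_comp.
by rewrite diracT mul1e ltry.
Qed.

(** Normalization is phrased as scaling by a positive constant, so the signs of integrals carry over
    from [nu] to [mu]. *)
Lemma normalizedP (nu : {measure set X -> \bar R}) : 0 < nu setT < +oo ->
  exists k : {nonneg R}, (0 < k%:num)%R /\
    exists mu : probability X R, (mu : set X -> \bar R) = mscale k nu.
Proof.
move=> /andP[nu0 nuoo].
have nufin : nu setT \is a fin_num by rewrite ge0_fin_numE.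
have fnu0 : (0 < fine (nu setT))%R by rewrite fine_gt0 ?nu0.
have k0 : (0 <= (fine (nu setT))^-1)%R by rewrite invr_ge0 ltW.
exists (NngNum k0); split; first by rewrite /= invr_gt0.
(* [mnormalize] takes a fallback probability; positive mass yields a point, whose Dirac measure is
   used. *)
have [x _] : exists x : X, setT x.
  apply/set0P/eqP => X0; by rewrite X0 measure0 ltxx in nu0.
exists (mnormalize nu \d_x); apply/funext => A.
rewrite [LHS]/(mnormalize nu \d_x A) /mnormalize ifF; last first.
  by rewrite gt_eqF// lt_eqF.
by rewrite muleC.
Qed.

End FiniteMeasures.

Lemma ae_le_integral d (T : measurableType d) (R : realType)
    (mu : {measure set T -> \bar R}) (f1 f2 : T -> \bar R) :
  mu.-integrable setT f1 -> mu.-integrable setT f2 ->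
  {ae mu, forall x, (f1 x <= f2 x)%E} ->
  (\int[mu]_x f1 x <= \int[mu]_x f2 x)%E.
Proof.
move=> if1 if2 [N [mN N0 fN]].
rewrite (negligible_integral mN measurableT if1 N0).
rewrite (negligible_integral mN measurableT if2 N0).
have mTN : measurable (setT `\` N) by exact: measurableD.
apply: le_integral => //.
- exact: integrableS if1.
- exact: integrableS if2.
- by move=> x /[!inE] -[_ Nx]; apply: contrapT => fx; apply/Nx/fN.
Qed.

(** * Hypotheses generated by finitely many functions, and dual vectors *)

Section GeneratedByFinitelyMany.
Context {dX : measure_display} {X : measurableType dX} {R : realType} {n : nat}.
Variable g : 'I_n -> X -> R.
Hypothesis mg : forall i, measurable_fun setT (g i).

Local Notation P := (generated_hypothesis (range g)).
Local Notation gvec x := (\row_i g i x : 'rV[R]_n).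
Local Notation full T :=
  (forall mu : probability X R, P mu -> mu.-negligible (~` T)).

Lemma integral_combination (mu : probability X R) (p : 'I_n -> R) :
  P mu -> (forall i, 0 <= p i) ->
  mu.-integrable setT (fun x => (\sum_i p i * g i x)%:E) /\
  (\int[mu]_x (\sum_i p i * g i x)%:E <= 0)%E.
Proof.
move=> Pmu p0.
have Pg i : mu.-integrable setT (EFin \o g i) /\ (\int[mu]_x (g i x)%:E <= 0)%E.
  by apply: Pmu; exists i.
have ig i : mu.-integrable setT (fun x => (p i)%:E * (g i x)%:E)%E.
  by apply: integrableZl => //; have [] := Pg i.
rewrite (_ : (fun x => _) =
    fun x => (\sum_i (p i)%:E * (g i x)%:E)%E); last first.
  by apply/funext => x; rewrite -sumEFin.
split; first exact: integrable_sum.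
rewrite integral_sum// sume_le0// => i _; have [igi gi0] := Pg i.
by rewrite integralZl// mule_ge0_le0// lee_fin.
Qed.

Lemma measurable_combination (p : 'I_n -> R) :
  measurable_fun setT (fun x => \sum_i p i * g i x).
Proof. by apply: measurable_sum => i; exact: measurable_funM. Qed.

Lemma dotc_gvec x (p : 'cV[R]_n) : dotc (gvec x) p = \sum_i p i 0 * g i x.
Proof. by rewrite dotcE; apply: eq_bigr => i _; rewrite mxE. Qed.

(** The combination is almost surely nonnegative with integral at most 0, so its absolute value
    integrates to 0. *)
Lemma combination_ae0 (mu : probability X R) (p : 'I_n -> R) (T : set X) :
  P mu -> (forall i, 0 <= p i) -> mu.-negligible (~` T) ->
  (forall x, T x -> 0 <= \sum_i p i * g i x) ->
  mu.-negligible (~` [set x | \sum_i p i * g i x = 0]).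
Proof.
move=> Pmu p0 muT Tp; have [ip ip0] := integral_combination Pmu p0.
set F := (X in mu.-integrable _ X) in ip.
have mF : measurable_fun setT F by exact: (measurable_int _ ip).
have F0 : {ae mu, forall x, (0 <= F x)%E}.
  apply: negligibleS muT => x /=; apply: contra_not => Tx.
  by rewrite lee_fin; exact: Tp.
have : (\int[mu]_x `|F x| = 0)%E.
  apply/eqP; rewrite eq_le integral_ge0// andbT.
  rewrite (ae_eq_integral F)//; first exact: measurableT_comp.
  by move: F0; apply: filterS => x Fx _; rewrite gee0_abs.
move/(ae_eq_integral_abs mu measurableT mF); apply: negligibleS => x /=.
by apply: contra_not => /(_ I) [].
Qed.

(* Each violation of the last conclusion confines [gvec] almost surely to a
   smaller subspace [W], so the dimension bounds the number of violations. *)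
Lemma effective_support : exists T : set X, [/\ measurable T, full T &
  forall p : 'cV[R]_n, (forall i, 0 <= p i 0) ->
    (forall x, T x -> 0 <= dotc (gvec x) p) ->
    forall x, T x -> dotc (gvec x) p = 0].
Proof.
(* The induction tracks a subspace containing [gvec] on [T], namely the row space of [W], whose
   dimension is less than [r]. *)
suff H r (W : 'M[R]_n) (T : set X) : (\rank W < r)%N -> measurable T ->
    full T -> (forall x, T x -> (gvec x <= W)%MS) ->
    exists T : set X, [/\ measurable T, full T &
  forall p : 'cV[R]_n, (forall i, 0 <= p i 0) ->
    (forall x, T x -> 0 <= dotc (gvec x) p) ->
    forall x, T x -> dotc (gvec x) p = 0].
  apply: (H n.+1 1%:M setT) => //; first by rewrite mxrank1.
    by move=> mu _; rewrite setCT; exact: negligible_set0.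
  by move=> x _; rewrite submx1.
elim: r W T => // r IH W T; rewrite ltnS => Wr mT fT TW.
have [[p [p0 Tp [x Tx px]]]|NA] := pselect (exists p : 'cV[R]_n,
    [/\ forall i, 0 <= p i 0, forall x, T x -> 0 <= dotc (gvec x) p &
    exists2 x, T x & dotc (gvec x) p <> 0]); last first.
  exists T; split => // p p0 Tp x Tx.
  by apply: contrapT => px; apply: NA; exists p; split => //; exists x.
pose Z := [set x | dotc (gvec x) p = 0].
have ZE : Z = [set x | \sum_i p i 0 * g i x = 0].
  by apply/seteqP; split => y; rewrite /Z/= dotc_gvec.
apply: (IH (W :&: kermx p)%MS (T `&` Z)).
- apply: leq_trans Wr; apply: rank_ltmx; rewrite ltmxE capmxSl/=.
  apply: contra_notN px => Wp.
  have /sub_kermxP := submx_trans (TW _ Tx) (submx_trans Wp (capmxSr _ _)).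
  by rewrite /dotc => ->; rewrite mxE.
- apply: measurableI => //; rewrite ZE.
  have := measurable_combination (p^~ 0) measurableT (measurable_set1 0).
  by rewrite setTI.
- move=> mu Pmu; rewrite setCI; apply: negligibleU; first exact: fT.
  rewrite ZE; apply: (combination_ae0 Pmu p0 (fT _ Pmu)) => y Ty.
  by rewrite -dotc_gvec; exact: Tp.
- move=> y [Ty py]; rewrite sub_capmx TW//=; apply/sub_kermxP.
  by apply/matrixP => i j; rewrite !ord1 [RHS]mxE.
Qed.

(** Coefficients of the vectors [(gvec y, - f y)] become point masses at [y]. The generators
    [(e_i, 0)] and [(0, 1)] add no mass and only loosen the bounds, whence inequalities instead of
    equalities. *)
Lemma conic_hull_measure (f : X -> R) (T : set X) (v : 'rV[R]_(n + 1)) :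
  measurable_fun setT f ->
  conic_hull (row_mx 0 1%:M |`
    ([set row_mx (gvec y) (- f y)%:M | y in T] `|`
     [set` [seq row_mx (delta_mx 0 i) 0 | i <- enum 'I_n]])) v ->
  exists nu : {measure set X -> \bar R}, [/\ (nu setT < +oo)%E,
    forall h : X -> R, measurable_fun setT h -> nu.-integrable setT (EFin \o h),
    forall i, (\int[nu]_x (g i x)%:E <= (lsubmx v 0 i)%:E)%E &
    ((- rsubmx v 0 0)%:E <= \int[nu]_x (f x)%:E)%E].
Proof.
move=> mf; elim=> [|a x w a0 Sx _ [nu [nuoo nuh nug nuf]]].
  exists mzero; split => //.
  - by rewrite /mzero ltry.
  - move=> h mh; apply/integrableP; split; first exact/measurable_EFinP.
    by rewrite integral_measure_zero.
  - by move=> i; rewrite integral_measure_zero linear0 mxE.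
  - by rewrite integral_measure_zero linear0 mxE oppr0.
rewrite linearD/= linearZ/= linearD/= linearZ/=.
case: Sx => [->|[[y Ty <-]|/mapP[j _ ->]]].
- exists nu; split => // [i|].
    by rewrite row_mxKl scaler0 add0r.
  apply: le_trans nuf; rewrite lee_fin row_mxKr !mxE eqxx mulr1 opprD.
  by rewrite gerDr oppr_le0.
- pose ka := NngNum a0.
  have idirac (h : X -> R) : measurable_fun setT h ->
      (mscale ka (\d_y : {measure set X -> \bar R})).-integrable setT
        (EFin \o h).
    by move=> mh; apply/integrable_mscale/integrable_dirac.
  have addE (h : X -> R) : measurable_fun setT h ->
      (\int[measure_add (mscale ka \d_y) nu]_x (h x)%:E =
       (a * h y)%:E + \int[nu]_x (h x)%:E)%E.
    move=> mh; rewrite integral_measure_add//.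
    + rewrite integral_mscale; last exact: integrable_dirac.
      rewrite integral_dirac//; last exact/measurable_EFinP.
      by rewrite diracT mul1e.
    + exact: idirac.
    + exact: nuh.
  exists (measure_add (mscale ka \d_y) nu); split.
  + have massE : measure_add (mscale ka \d_y) nu setT = (a%:E + nu setT)%E.
      rewrite measure_addE; congr (_ + _)%E.
      by transitivity (a%:E * dirac y [set: X])%E; last by rewrite diracT mule1.
    apply: le_lt_trans (lte_add_pinfty (ltry a) nuoo).
    by rewrite -massE; exact: lexx.
  + by move=> h mh; apply: integrable_measure_add; [exact: idirac|exact: nuh].
  + move=> i; rewrite addE// row_mxKl !mxE EFinD leeD2l//.
    by have := nug i; rewrite mxE.
  + rewrite addE// row_mxKr !mxE eqxx mulr1n opprD mulrN opprK EFinD leeD2l//.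
    by have := nuf; rewrite mxE.
- exists nu; split => // [i|].
    apply: le_trans (nug i) _; rewrite lee_fin row_mxKl [leRHS]mxE lerDr !mxE.
    by rewrite mulr_ge0.
  by rewrite row_mxKr scaler0 add0r.
Qed.

(** A separating functional with value 1 at [(0, 1)] has the form [(p, 1)]. Its signs on the
    generators say that [p >= 0] and that [f <= p . g] on the set [T] of full measure. *)
Lemma superhedging (f : X -> R) : measurable_fun setT f ->
  (forall mu : probability X R, P mu -> mu.-integrable setT (EFin \o f) ->
     (\int[mu]_x (f x)%:E <= 0)%E) ->
  exists2 p : 'I_n -> R, (forall i, 0 <= p i) &
    quasi_surely P (fun x => f x <= \sum_i p i * g i x).
Proof.
move=> mf Pf; have [T [mT fT NA]] := effective_support.
(* The [(e_i, 0)] go into the finite list because [effective_support] forces functionals to vanish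
   on the vectors [gvec y] only, not on the [e_i]. *)
have [||p [Sp Ep zp]] := @polyhedral_separation R (n + 1)
    [set row_mx (gvec y) (- f y)%:M | y in T]
    [seq row_mx (delta_mx 0 i) 0 | i <- enum 'I_n] (row_mx 0 1%:M).
(* If [(0, -1)] were in the cone, some [nu] would integrate every [g i] to at most 0 and [f] to at
   least 1. Normalized, it would lie in [P] and contradict [Pf]. *)
- move=> /(conic_hull_measure mf)[nu [nuoo nuh nug nuf]].
  have nu_gt0 : (0 < nu setT)%E.
    rewrite lt0e measure_ge0 andbT; apply/eqP => nu0.
    have f0 : (`|\int[nu]_x (f x)%:E| == 0)%E.
      rewrite eq_le abse_ge0 andbT.
      apply: le_trans (le_abse_integral _ _ _) _ => //.
        exact/measurable_EFinP.
      by rewrite integral_abs_eq0//; exact/measurable_EFinP.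
    rewrite abse_eq0 in f0; move: nuf.
    by rewrite (eqP f0) lee_fin linearN/= row_mxKr !mxE eqxx opprK ler10.
  have [|k [k0 [mu muE]]] := @normalizedP _ _ _ nu; first by rewrite nu_gt0.
  have imu (h : X -> R) :
      measurable_fun setT h -> mu.-integrable setT (EFin \o h).
    by move=> mh; rewrite muE; apply: integrable_mscale; exact: nuh.
  have Pmu : P mu.
    move=> _ [i _ <-]; split; first exact: imu.
    rewrite muE integral_mscale; last exact: nuh.
    rewrite mule_ge0_le0//; apply: le_trans (nug i) _.
    by rewrite lee_fin linearN/= row_mxKl !mxE oppr0.
  have := Pf mu Pmu (imu _ mf); rewrite muE integral_mscale; last exact: nuh.
  apply/negP; rewrite -ltNge mule_gt0// (lt_le_trans _ nuf)//.
  by rewrite lte_fin linearN/= row_mxKr !mxE eqxx opprK.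
(* A functional vanishing at [(0, 1)] has last component 0, which reduces the claim to the defining
   property of [T]. *)
- move=> p Sp Ep zp _ [y Ty <-].
  have p2 : dsubmx p = 0.
    move: zp; rewrite -[p]vsubmxK dotc_row dot0c add0r col_mxKd => p20.
    apply/matrixP => i j; rewrite !ord1 [RHS]mxE.
    by move: p20; rewrite /dotc mul1mx.
  have pE x (b : 'rV[R]_1) :
      dotc (row_mx (gvec x) b) p = dotc (gvec x) (usubmx p).
    by rewrite -[p in LHS]vsubmxK dotc_row p2 [dotc b 0]/dotc mulmx0 mxE addr0.
  rewrite pE; apply: NA => // [i|x Tx].
    have := Ep (row_mx (delta_mx 0 i) 0); rewrite -[in dotc _ p](vsubmxK p).
    rewrite dotc_row dotc_delta dot0c addr0; apply.
    by apply: map_f; rewrite mem_enum.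
  by rewrite -(pE _ (- f x)%:M); apply: Sp; exists x.
have p2 : dsubmx p = 1%:M.
  move: zp; rewrite -[p]vsubmxK dotc_row dot0c add0r col_mxKd => p20.
  apply/matrixP => i j; rewrite !ord1 [RHS]mxE eqxx mulr1n.
  by move: p20; rewrite /dotc mul1mx.
exists (fun i => usubmx p i 0) => [i|].
  have := Ep (row_mx (delta_mx 0 i) 0); rewrite -[in dotc _ p](vsubmxK p).
  rewrite dotc_row dotc_delta dot0c addr0; apply.
  by apply: map_f; rewrite mem_enum.
have Tf x : T x -> f x <= \sum_i usubmx p i 0 * g i x.
  move=> Tx; have := Sp (row_mx (gvec x) (- f x)%:M).
  rewrite -[in dotc _ p](vsubmxK p) dotc_row p2 dotc_scalar mulr1 subr_ge0.
  by rewrite dotc_gvec; apply; exists x.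
have mQ : measurable [set x | ~ f x <= \sum_i usubmx p i 0 * g i x].
  have /measurable_EFinP mEf := mf.
  have /measurable_EFinP mEg := measurable_combination (usubmx p ^~ 0).
  have := measurableC (measurable_lee measurableT mEf mEg).
  by rewrite setTI.
split => // mu Pmu; apply/negligibleP => //.
by apply: negligibleS (fT _ Pmu) => x /=; apply: contra_not; exact: Tf.
Qed.

End GeneratedByFinitelyMany.

(** * Dual description of nonpositive expectations and of e-variables *)

Theorem theorem3p1 (dX : measure_display) (X : measurableType dX)
    (R : realType) (d : nat) (d_gt0 : (0 < d)%N) (g : 'I_d -> X -> R)
    (mg : forall i : 'I_d, measurable_fun setT (g i)) :
  let Phi : set (X -> R) := range g in
  let P : set (probability X R) := generated_hypothesis Phi in
  (forall f : X -> R, calL Phi f ->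
     ((forall mu : probability X R, P mu -> (\int[mu]_x (f x)%:E <= 0)%E) <->
      exists2 p : 'I_d -> R, (forall i : 'I_d, 0 <= p i) &
        quasi_surely P (fun x => f x <= \sum_(i < d) p i * g i x))) /\
  e_variables P =
    [set h : X -> \bar R |
       [/\ measurable_fun setT h, forall x : X, (0 <= h x)%E &
         exists2 p : 'I_d -> R, (forall i : 'I_d, 0 <= p i) &
           quasi_surely P
             (fun x => (h x <= (1 + \sum_(i < d) p i * g i x)%:E)%E)]].
Proof.
move=> Phi P; split.
  move=> f [mf intf]; split => [Pf|[p p0 [mQ Q0]] mu Pmu].
    by apply: superhedging => // mu Pmu _; exact: Pf.
  have [ip ip0] := integral_combination Pmu p0.
  apply: le_trans ip0; apply: ae_le_integral => //; first exact: intf.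
  exists [set x | ~ f x <= \sum_(i < d) p i * g i x].
  by split => //; exact: Q0.
apply/seteqP; split => h [mh h0].
- move=> Ph; split => //.
  have ih mu : P mu -> mu.-integrable setT h.
    move=> Pmu; apply/integrableP; split => //.
    under eq_integral do rewrite gee0_abs//.
    by rewrite (le_lt_trans (Ph _ Pmu))// ltry.
  have mfh : measurable_fun setT (fine \o h) by exact: measurableT_comp.
  (* [fine] sends [+oo] to 0, so it can only lower the nonnegative [h], and [fine (h x) - 1]
     integrates to at most 0. *)
  have fhle x : ((fine (h x))%:E <= h x)%E.
    by have := h0 x; case: (h x) => //= r _; rewrite leey.
  have fh0 x : (0 <= (fine (h x))%:E)%E by rewrite lee_fin fine_ge0.
  have [||p p0 [mQ Q0]] := superhedging mg (f := fun x => fine (h x) - 1).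
  + exact: measurable_funB.
  + move=> mu Pmu _.
    have ifh : mu.-integrable setT (fun x => (fine (h x))%:E).
      apply: le_integrable (ih _ Pmu) => //; first exact/measurable_EFinP.
      by move=> x _; rewrite !gee0_abs.
    have i1 : mu.-integrable setT (fun=> 1%:E).
      exact: finite_measure_integrable_cst.
    under eq_integral do rewrite EFinB.
    rewrite integralB//= (integral_cst mu measurableT 1).
    rewrite [X in (_ * X)%E](probability_setT mu) mule1 sube_le0.
    apply: le_trans (Ph _ Pmu); apply: le_integral => //; first exact: ih.
  exists p => //.
  have mEg := measurable_combination mg p.
  have mQ' : measurable
      [set x | ~ (h x <= (1 + \sum_(i < d) p i * g i x)%:E)%E].
    have /measurable_EFinP mF :
        measurable_fun setT (fun x => 1 + \sum_(i < d) p i * g i x).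
      exact: measurable_funD.
    by have := measurableC (measurable_lee measurableT mh mF); rewrite setTI.
  split => // mu Pmu; apply/negligibleP => //.
  have hfin := integrable_ae measurableT (ih _ Pmu).
  have /negligibleP hQ := Q0 mu Pmu.
  (* The bound on [h] can fail only where [h] is infinite or where the bound on [fine (h x) - 1]
     fails. *)
  apply: negligibleS (negligibleU hfin (hQ mQ)) => x /= nhx.
  have [hx|hx] := boolP (h x \is a fin_num); [right|left].
    apply: contra_not nhx => fx; rewrite -(fineK hx) lee_fin; lra.
  by move=> /(_ I); exact/negP.
- move=> [p p0 [mQ Q0]]; split => // mu Pmu.
  have [ip ip0] := integral_combination Pmu p0.
  have i1 : mu.-integrable setT (fun=> 1%:E).
    exact: finite_measure_integrable_cst.
  pose F x : \bar R := (1 + \sum_(i < d) p i * g i x)%:E.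
  have iF : mu.-integrable setT F.
    exact: eq_integrable (integrableD measurableT i1 ip).
  have hF : {ae mu, forall x, (h x <= F x)%E}.
    exists [set x | ~ (h x <= F x)%E]; split => //; exact: Q0.
  (* Almost surely [h] lies between 0 and the positive part of the integrable [F]. *)
  have ih : mu.-integrable setT h.
    apply/integrableP; split => //.
    under eq_integral do rewrite gee0_abs//.
    have iFp := integrable_funepos measurableT iF.
    apply: le_lt_trans (integrable_lty measurableT iFp).
    apply: ae_ge0_le_integral => //; first exact: (measurable_int _ iFp).
    move: hF; apply: filterS => x hFx _.
    by rewrite (le_trans hFx)// funeposE le_max lexx.
  apply: le_trans (ae_le_integral ih iF hF) _.
  under eq_integral do rewrite /F EFinD.
  rewrite integralD//= (integral_cst mu measurableT 1).
  rewrite [X in (_ * X)%E](probability_setT mu) mule1.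
  by rewrite -[leRHS]adde0 leeD2l.
Qed.
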